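(* Let $T$ be Thompson's group $T$ acting on the circle $S^1$. Let $H$ be a finite set of nontrivial elements in $T$ such that there is some point $p\in\bigcap_{h\in H}\mathrm{Supp}(h)$. Then for any positive integer $n$ there is an element $g\in T$ and elements $\{c_1,c_2,\ldots,c_n\}$ with $c_i\in C_T(g)$ for all $i$, such that for all $h\in H$ the set $$G_h:=\{(gh)^{c_i}\mid i\in\{1,2,\ldots,n\}\}$$ is a free basis for a free group of rank $n$.
   Context: $S^1=\mathbb{R}/\mathbb{Z}$. Thompson's group $T$ is the group of orientation-preserving piecewise-linear homeomorphisms of $S^1$ that map the set $\mathbb{Z}[\frac12]/\mathbb{Z}$ of dyadic rational points to itself, are differentiable except at finitely many dyadic rational points, and whose slopes (where defined) are integer powers of $2$. It acts on $S^1$ on the left, so products are composed right to left. For $g\in T$, $\mathrm{Supp}(g)=\{x\in S^1: g\cdot x\neq x\}$; $C_T(g)$ is the centralizer of $g$ in $T$. Conjugation is $h^c:=chc^{-1}$. *)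

(* Defs.v *)
From HB Require Import structures.
From mathcomp Require Import all_boot all_order all_algebra.
From mathcomp Require Import all_classical all_reals all_analysis.

Set Implicit Arguments.
Unset Strict Implicit.
Unset Printing Implicit Defensive.

Import Order.TTheory GRing.Theory Num.Theory.
Import numFieldNormedType.Exports.

Local Open Scope classical_set_scope.
Local Open Scope ring_scope.
Local Open Scope quotient_scope.

Section GroupTheory.
Local Open Scope group_scope.
Variable G : groupType.
Implicit Types (S K : set G) (g h c x y : G).

Definition is_subgroup K := K 1 /\ forall x y, K x -> K y -> K (x / y).

Definition gen_subgroup S : set G := smallest is_subgroup S.

(* Universal property of the free group: every map from [S] to a group extends
   uniquely to a homomorphism on [K]. Maps are represented by functions on [G],
   of which only the values on [S] (resp. [K]) are relevant. *)
Definition is_free_basis S K :=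
  [/\ is_subgroup K, S `<=` K
    & forall (L : groupType) (f : G -> L),
        let extends (phi : G -> L) :=
          {in K &, {morph phi : x y / x * y}} /\ {in S, phi =1 f} in
        exists2 phi, extends phi
                   & forall psi, extends psi -> {in K, psi =1 phi}].

Definition centralizer_in K g : set G := [set c | K c /\ commute c g].

(* Left conjugation, whereas the library's [h ^ c] is [c^-1 * h * c]. *)
Definition conjl h c := c * h * c^-1.
End GroupTheory.

Section Homeo.
Variable X : topologicalType.
Implicit Types f g : X -> X.

Definition homeomorphism f :=
  continuous f /\ exists g, [/\ continuous g, cancel f g & cancel g f].

Record homeo := Homeo {
  homeo_fun :> X -> X;
  homeo_subproof : `[< homeomorphism homeo_fun >] }.

HB.instance Definition _ := [isSub for homeo_fun].
HB.instance Definition _ := [Choice of homeo by <:].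

Lemma homeoP (u : homeo) : homeomorphism u.
Proof. exact/asboolP/homeo_subproof. Qed.

Definition homeo_inv_fun (u : homeo) : X -> X := sval (cid (homeoP u).2).

Lemma homeo_inv_funP (u : homeo) :
  [/\ continuous (homeo_inv_fun u), cancel u (homeo_inv_fun u)
    & cancel (homeo_inv_fun u) u].
Proof. exact: svalP (cid (homeoP u).2). Qed.

Lemma homeomorphism_id : homeomorphism id.
Proof. by split=> [x //|]; exists id; split=> // x. Qed.

Lemma homeomorphism_comp (u v : homeo) : homeomorphism (u \o v).
Proof.
have [uc [u' [u'c uK u'K]]] := homeoP u.
have [vc [v' [v'c vK v'K]]] := homeoP v.
split; first by move=> x; apply: continuous_comp; [exact: vc|exact: uc].
exists (v' \o u'); split; try exact: can_comp.
by move=> x; apply: continuous_comp; [exact: u'c|exact: v'c].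
Qed.

Lemma homeomorphism_inv (u : homeo) : homeomorphism (homeo_inv_fun u).
Proof.
have [ic uK iK] := homeo_inv_funP u.
by split=> //; exists u; split=> //; exact: (homeoP u).1.
Qed.

Definition homeo_one : homeo := Homeo (asboolT homeomorphism_id).
Definition homeo_mul (u v : homeo) : homeo :=
  Homeo (asboolT (homeomorphism_comp u v)).
Definition homeo_inv (u : homeo) : homeo :=
  Homeo (asboolT (homeomorphism_inv u)).

Lemma homeo_mulA : associative homeo_mul.
Proof. by move=> u v w; apply: val_inj. Qed.
Lemma homeo_mul1 : left_id homeo_one homeo_mul.
Proof. by move=> u; apply: val_inj. Qed.
Lemma homeo_1mul : right_id homeo_one homeo_mul.
Proof. by move=> u; apply: val_inj. Qed.
Lemma homeo_mulV : left_inverse homeo_one homeo_inv homeo_mul.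
Proof.
move=> u; apply: val_inj; apply/funext => x /=.
by have [_ uK _] := homeo_inv_funP u; exact: uK.
Qed.
Lemma homeo_Vmul : right_inverse homeo_one homeo_inv homeo_mul.
Proof.
move=> u; apply: val_inj; apply/funext => x /=.
by have [_ _ iK] := homeo_inv_funP u; exact: iK.
Qed.

(* The product is composition from right to left: [(u * v)%g x = u (v x)]. *)
HB.instance Definition _ := isGroup.Build homeo
  homeo_mulA homeo_mul1 homeo_1mul homeo_mulV homeo_Vmul.

Definition Supp (u : homeo) : set X := [set x | u x <> x].
End Homeo.

Section Thompson.
Variable R : realType.

Definition integers : zmodClosed R :=
  GRing.ZmodClosed.clone R (@Num.int_num_subdef R) _.

Definition circle := quotient_topology (Quotient.quot integers).

HB.instance Definition _ := Quotient.on circle.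
HB.instance Definition _ := Topological.on circle.

Definition circle_pi (x : R) : circle := \pi_circle x.

Lemma circle_piP x y :
  circle_pi x = circle_pi y <-> exists m : int, x = y + m%:~R.
Proof.
have E : circle_pi x = circle_pi y <-> x - y \is a Num.int.
  split=> [xy|].
    by rewrite [_ \is a _](Quotient.idealrBE integers); exact/eqP.
  by rewrite [_ \is a _](Quotient.idealrBE integers) => /eqP.
apply: (iff_trans E); split=> [/intrP[m /eqP]|[m ->]].
  by rewrite subr_eq addrC => /eqP ->; exists m.
by rewrite addrC addKr; exact: intr_int.
Qed.

Definition dyadic_rational : set R :=
  [set x | exists (m : int) (n : nat), x = m%:~R / 2 ^+ n].

Definition dyadic : set circle := circle_pi @` dyadic_rational.

(* Orientation, differentiability and slopes of a self-map of the circle are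
   those of its lifts to the real line; two (continuous) lifts differ by an
   integer constant. *)
Definition is_lift (f : circle -> circle) (F : R -> R) :=
  continuous F /\ forall x, f (circle_pi x) = circle_pi (F x).

Definition piecewise_linear (F : R -> R) :=
  exists2 B : set circle, finite_set B &
    forall a b : R, (forall x, a < x < b -> ~ B (circle_pi x)) ->
      exists s t : R, forall x, a < x < b -> F x = s * x + t.

Definition thompson_T : set (homeo circle) :=
  [set u : homeo circle | u @` dyadic `<=` dyadic /\
    exists F : R -> R,
      [/\ is_lift u F,
          {homo F : x y / x < y},
          piecewise_linear F,
          exists2 B : set circle, finite_set B /\ B `<=` dyadic &
            forall x, ~ B (circle_pi x) -> derivable F x 1
        & forall x, derivable F x 1 -> exists k : int, 'D_1 F x = 2 ^ k]].
End Thompson.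

Arguments integers R : clear implicits.
Arguments dyadic_rational R : clear implicits.
Arguments dyadic R : clear implicits.
Arguments thompson_T R : clear implicits.

(* Main.v *)
Require Import Defs.
From HB Require Import structures.
From mathcomp Require Import all_boot all_order all_algebra.
From mathcomp Require Import finmap.
From mathcomp Require Import all_classical all_reals all_analysis.
From mathcomp Require Import lra ring zify.

(** The proof is a ping-pong argument. A point [p] in all the supports has an arc
   [U] around it such that [h U] is disjoint from [U] for every [h] in [H]
   ([moved_arc]); so, with [K] the complement of [U], each [h] maps the complement
   of [K] into [K]. Choose [g] and [c_i] in T such that [c_i] commutes with [g]
   and all the sets [c_i K] and [g c_i K] are pairwise disjoint. Then
   [c_i (g h) c_i^-1 = g (c_i h c_i^-1)] maps the complement of [c_i K] into
   [g c_i K], so that these elements play ping-pong with the [2n] disjoint sets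
   ([ping_pong_conjugates]), and reduced words in them are nontrivial
   ([ping_pong], [free_basis_of_words]). Only [U] enters the choice of [g]
   and the [c_i], hence they serve all [h] in [H] at once.

   To find [g] and the [c_i], take for [g] a conjugate of the half-turn [rho]:
   many elements commute with [rho], namely those whose lifts to the real line
   commute with the translation by [1/2]. Let [stretch] be the element of
   Thompson's group F with slopes 2, 1 and 1/2 on the intervals with end points
   0, 1/4, 1/2 and 1. It fixes 0 and pushes every other point of the circle
   towards 1. A power of [stretch] followed by a translation is an element [phi]
   of T such that [phi^-1 K] lies in an arc from some [e > 0] to [1/4]
   ([stretch_out_arc]). The element [w] with lift [x |-> stretch (2 * x) / 2]
   commutes with [rho], preserves the open arc from 0 to 1/2, and some power
   [w ^+ M] pushes the arc from [e] to [1/4] off itself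
   ([iter_stretch_gt_half]). Hence the [w ^+ (M * i)] map this arc to disjoint
   arcs between 0 and 1/2, and composing with [rho] puts the images between 1/2
   and 1. Conjugation by [phi] gives [g] and the [c_i]. *)

Set Implicit Arguments.
Unset Strict Implicit.
Unset Printing Implicit Defensive.

Import Order.TTheory GRing.Theory Num.Theory.

Local Open Scope classical_set_scope.
Local Open Scope group_scope.

(** * Free bases and words *)

Section Words.
Variable I : choiceType.

(** A letter [(i, e)] stands for the generator of index [i] if [e = false], and
   for its inverse if [e = true]. *)
Definition letter := (I * bool)%type.

Definition letter_inv (x : letter) : letter := (x.1, ~~ x.2).

Definition word_inv (w : seq letter) := rev (map letter_inv w).

Definition word_reduced (w : seq letter) :=
  sorted (fun x y => y != letter_inv x) w.

Definition letter_val (L : groupType) (a : I -> L) (x : letter) : L :=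
  if x.2 then (a x.1)^-1 else a x.1.

Definition word_val (L : groupType) (a : I -> L) (w : seq letter) : L :=
  foldr (fun x z => letter_val a x * z) 1 w.

Lemma letter_valV (L : groupType) (a : I -> L) x :
  letter_val a (letter_inv x) = (letter_val a x)^-1.
Proof. by case: x => i []; rewrite /letter_val //= invgK. Qed.

Lemma word_val_cat (L : groupType) (a : I -> L) u v :
  word_val a (u ++ v) = word_val a u * word_val a v.
Proof. by elim: u => [|x u IHu] /=; rewrite ?mul1g // IHu mulgA. Qed.

Lemma word_valV (L : groupType) (a : I -> L) w :
  word_val a (word_inv w) = (word_val a w)^-1.
Proof.
elim: w => [|x w IHw] /=; first by rewrite invg1.
rewrite /word_inv map_cons rev_cons -cats1 word_val_cat IHw /= mulg1.
by rewrite letter_valV invgM.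
Qed.

Lemma not_reducedP w : ~~ word_reduced w ->
  exists u x v, w = u ++ [:: x, letter_inv x & v].
Proof.
case: w => // x w; rewrite /word_reduced /=; elim: w x => //= y w IHw x.
rewrite negb_and negbK => /orP[/eqP ->|/IHw[u [z [v]]]].
  by exists [::], x, w.
by case: u => [|t u] [-> ->]; [exists [:: x], z, v | exists [:: x, t & u], z, v].
Qed.

(** A nonempty word with value 1 is not reduced, and cancelling two inverse
   letters changes its value in no group: the word shrinks to the empty word. *)
Lemma word_val_eq1 (G L : groupType) (a : I -> G) (b : I -> L) :
    (forall w, word_reduced w -> w != [::] -> word_val a w <> 1) ->
  forall w, word_val a w = 1 -> word_val b w = 1.
Proof.
move=> a_free w; have [n] := ubnP (size w); elim: n w => // n IHn w le_wn aw1.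
have [->//|w_neq0] := eqVneq w [::].
have [/a_free/(_ w_neq0)//|/not_reducedP[u [x [v def_w]]]] :=
  boolP (word_reduced w).
have cancel_w (K : groupType) (f : I -> K) : word_val f w = word_val f (u ++ v).
  by rewrite def_w !word_val_cat /= letter_valV mulVKg.
rewrite cancel_w; apply: IHn; last by rewrite -cancel_w.
by move: le_wn; rewrite def_w !size_cat /= !addnS ltnS => /ltnW.
Qed.

Section FreeBasis.
Variables (G : groupType) (a : I -> G).

Let S := [set a i | i in [set: I]].

Lemma gen_subgroup_wordE : gen_subgroup S = [set word_val a w | w in [set: seq letter]].
Proof.
apply/seteqP; split=> [x|_ [w _ <-] M [[M1 Mdiv] SM]].
  apply: smallest_sub => [|_ [i _ <-]]; last first.
    by exists [:: (i, false)]; rewrite //= mulg1.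
  split=> [|_ _ [u _ <-] [v _ <-]]; first by exists [::].
  by exists (u ++ word_inv v); rewrite // word_val_cat word_valV.
have MV y : M y -> M y^-1 by move/(Mdiv _ _ M1); rewrite div1g.
have Ma i : M (a i) by apply: SM; exists i.
elim: w => [//|[i e] w Mw] /=; rewrite -[word_val a w]invgK; apply: Mdiv.
  by case: e; rewrite /letter_val /=; [exact: MV|exact: Ma].
exact: MV.
Qed.

(** The extension of [f] is read on any word that represents the given element;
   [word_val_eq1] makes the result independent of the word. *)
Lemma free_basis_of_words :
    (forall w, word_reduced w -> w != [::] -> word_val a w <> 1) ->
  is_free_basis S (gen_subgroup S).
Proof.
move=> a_free; set K := gen_subgroup S.
have KE : K = [set word_val a w | w in [set: seq letter]].
  exact: gen_subgroup_wordE.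
have Kword w : word_val a w \in K by rewrite inE KE; exists w.
have SK : S `<=` K by exact: sub_smallest.
have K_sub : is_subgroup K.
  rewrite KE; split=> [|_ _ [u _ <-] [v _ <-]]; first by exists [::].
  by exists (u ++ word_inv v); rewrite // word_val_cat word_valV.
split=> // L f /=; pose b i := f (a i).
have word_val_ext u v : word_val a u = word_val a v -> word_val b u = word_val b v.
  move=> uv; apply: divg1_eq; rewrite -word_valV -word_val_cat.
  by apply: (word_val_eq1 b a_free); rewrite word_val_cat word_valV uv mulgV.
pose phi x := word_val b (xget [::] [set w | word_val a w = x]).
have phiE w : phi (word_val a w) = word_val b w.
  apply: word_val_ext; pose P := [set v | word_val a v = word_val a w].
  by apply: (@xgetPex _ [::] P); exists w.
exists phi; first split.
- move=> x y; rewrite !inE KE => -[u _ <-] [v _ <-].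
  by rewrite -word_val_cat !phiE word_val_cat.
- move=> x; rewrite inE => -[i _ <-].
  by have := phiE [:: (i, false)]; rewrite /= !mulg1.
move=> psi [psiM psiS] x; rewrite inE KE => -[w _ <-]; rewrite phiE.
have K1 : 1 \in K by exact: (Kword [::]).
have psi1 : psi 1 = 1.
  by apply: (@mulgI _ (psi 1)); rewrite -psiM // mulg1 mulg1.
have psia i : psi (a i) = b i by apply: psiS; rewrite inE; exists i.
have Kletter y : letter_val a y \in K by have := Kword [:: y]; rewrite /= mulg1.
have psi_letter y : psi (letter_val a y) = letter_val b y.
  case: y => i []; rewrite /letter_val /=; last exact: psia.
  have Ka : a i \in K by exact: (Kletter (i, false)).
  have KaV : (a i)^-1 \in K by exact: (Kletter (i, true)).
  by apply: esym; apply: mulg1_eq; rewrite -psia -psiM // mulgV psi1.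
by elim: w => [//|y w IHw] /=; rewrite psiM // IHw psi_letter.
Qed.

End FreeBasis.
End Words.

(** * Ping-pong *)

Lemma homeo_ext (X : topologicalType) (u v : homeo X) : u =1 v -> u = v.
Proof. by move=> uv; apply: val_inj; apply/funext. Qed.

Lemma homeo_inj (X : topologicalType) (u : homeo X) : injective u.
Proof.
move=> x y uxy; have uVK z : (u^-1 * u) z = z by rewrite mulVg.
by rewrite -(uVK x) -(uVK y) /= uxy.
Qed.

(** By induction on the length, every nonempty reduced word moves [o] into the set
   attached to its first letter: [A i] for [a i], [B i] for the inverse of [a i].
   A condition on [a i] alone is enough, because it also says that the inverse of
   [a i] maps the complement of [A i] into [B i]. *)
Lemma ping_pong (X : topologicalType) (I : choiceType) (a : I -> homeo X)
    (A B : I -> set X) (o : X) :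
    (forall i x, ~ B i x -> A i (a i x)) ->
    (forall i j x, A i x -> A j x -> i = j) ->
    (forall i j x, B i x -> B j x -> i = j) ->
    (forall i j x, A i x -> ~ B j x) ->
    (forall i, ~ A i o) -> (forall i, ~ B i o) ->
  let S := [set a i | i in [set: I]] in
  is_free_basis S (gen_subgroup S) /\ injective a.
Proof.
move=> aBA AA BB AB Ao Bo S; split; last first.
  move=> i j aij; apply: (AA i j (a i o)); first exact: aBA (Bo i).
  by rewrite aij; exact: aBA (Bo j).
have aVK i x : a i ((a i)^-1 x) = x.
  by rewrite -[LHS]/((a i * (a i)^-1) x) mulgV.
have aVAB i x : ~ A i x -> B i ((a i)^-1 x).
  by move=> Aix; apply: contrapT => /aBA; rewrite aVK.
pose C (x : letter I) := if x.2 then B x.1 else A x.1.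
have CC x y p : C x p -> C y p -> x = y.
  case: x y => [i [|]] [j [|]]; rewrite /C /=.
  - by move=> Bi Bj; congr (_, _); exact: BB Bi Bj.
  - by move=> Bi /AB/(_ Bi).
  - by move=> /AB nB /nB.
  - by move=> Ai Aj; congr (_, _); exact: AA Ai Aj.
have Co x : ~ C x o by case: x => i []; rewrite /C /=.
have C_letter x p : ~ C (letter_inv x) p -> C x (letter_val a x p).
  by case: x => i [] nCp; [exact: aVAB | exact: aBA].
apply: free_basis_of_words => w w_red w_neq0 w1.
suff : forall x w', word_reduced (x :: w') -> C x (word_val a (x :: w') o).
  case: w w_red w_neq0 w1 => // x w' w_red _ w1 moves_o; apply: (Co x).
  by have := moves_o x w' w_red; rewrite w1.
move=> {w w_red w_neq0 w1} x w; elim: w x => [|y w IHw] x.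
  have -> : word_val a [:: x] = letter_val a x by rewrite /= mulg1.
  by move=> _; apply: C_letter; exact: Co.
move=> /andP[y_neq /IHw Cy]; apply: C_letter => /CC/(_ Cy) def_y.
by rewrite -def_y eqxx in y_neq.
Qed.

(** As [c i] commutes with [g], the conjugate of [g * h] by [c i] is
   [g * c i * h * (c i)^-1]. It maps the complement of [c i @` K] into
   [(g * c i) @` K], which are therefore its repelling and attracting sets. *)
Lemma ping_pong_conjugates (X : topologicalType) (I : choiceType)
    (g h : homeo X) (c : I -> homeo X) (K : set X) (o : X) :
    (forall i, commute (c i) g) ->
    (forall p, ~ K p -> K (h p)) ->
    (forall i j p q, K p -> K q -> c i p = c j q -> i = j) ->
    (forall i j p q, K p -> K q -> g (c i p) <> c j q) ->
    (forall i p, K p -> g (c i p) <> o) ->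
    (forall i p, K p -> c i p <> o) ->
  let a i := conjl (g * h) (c i) in
  let S := [set a i | i in [set: I]] in
  is_free_basis S (gen_subgroup S) /\ injective a.
Proof.
move=> cg hK cc gcc gco co a S.
apply: (@ping_pong _ _ _ (fun i => (g * c i) @` K) (fun i => c i @` K) o).
- move=> i x ncKx; pose y := (c i)^-1 x.
  have xE : x = c i y by rewrite -[RHS]/((c i * (c i)^-1) x) mulgV.
  exists (h y); first by apply: hK => Ky; apply: ncKx; exists y.
  have -> : a i = g * c i * h * (c i)^-1 by rewrite /a /conjl mulgA cg.
  by [].
- by move=> i j _ [p Kp <-] [q Kq /(@homeo_inj _ g)/esym]; exact: cc.
- by move=> i j _ [p Kp <-] [q Kq /esym]; exact: cc.
- by move=> i j _ [p Kp <-] [q Kq /esym]; exact: gcc.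
- by move=> i [p Kp]; exact: gco.
- by move=> i [p Kp]; exact: co.
Qed.

(** * Elements of T from lifts to the real line *)

Section Lifts.
Import numFieldNormedType.Exports.
Local Open Scope ring_scope.
Variable R : realType.
Implicit Types (F G : R -> R) (x y t : R) (u v : homeo (circle R)).
Let pi := @circle_pi R.

Lemma dyadic_rationalD x y :
  dyadic_rational R x -> dyadic_rational R y -> dyadic_rational R (x + y).
Proof.
move=> [m [n ->]] [m' [n' ->]]; exists (m * 2 ^+ n' + m' * 2 ^+ n), (n + n')%N.
rewrite rmorphD !rmorphM !rmorphXn /= exprD.
have p2 k : (2 ^+ k : R) != 0 by rewrite expf_neq0 // pnatr_eq0.
by field; rewrite !p2.
Qed.

Lemma dyadic_rational_exp2 (k : int) x :
  dyadic_rational R x -> dyadic_rational R (2 ^ k * x).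
Proof.
move=> [m [n ->]]; case: k => k.
  by exists (2 ^+ k * m), n; rewrite rmorphM rmorphXn /= mulrA.
exists m, (k.+1 + n)%N; rewrite NegzE -exprnN exprD invfM.
by rewrite mulrCA.
Qed.

Lemma dyadic_rationalN x : dyadic_rational R x -> dyadic_rational R (- x).
Proof. by move=> [m [n ->]]; exists (- m), n; rewrite rmorphN mulNr. Qed.

Lemma dyadic_rational_int (m : int) : dyadic_rational R m%:~R.
Proof. by exists m, 0%N; rewrite expr0 divr1. Qed.

Lemma dyadic_rational_half x : dyadic_rational R x -> dyadic_rational R (x / 2).
Proof.
by move/(dyadic_rational_exp2 (- 1)); rewrite -exprN1 mulrC.
Qed.

Lemma dyadic_circle_piP x : dyadic R (pi x) <-> dyadic_rational R x.
Proof.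
split=> [[y y_dyadic /circle_piP[m def_y]]|]; last by exists x.
have -> : x = y + (- m)%:~R by rewrite def_y rmorphN addrK.
exact: dyadic_rationalD y_dyadic (dyadic_rational_int _).
Qed.

Lemma increasing_bij_continuous F F' :
  cancel F F' -> cancel F' F -> {homo F : x y / x < y} -> continuous F.
Proof.
move=> FK F'K F_incr x; apply/cvgrPdist_lt => e e_gt0.
have F_mono : {mono F : x y / x < y} by exact: leW_mono (le_mono F_incr).
have x_in : x \in `]F' (F x - e), F' (F x + e)[.
  by rewrite in_itv /= -!(F_mono (F' _)) -(F_mono x) !F'K gtrBl ltrDl e_gt0.
have := near_in_itvoo x_in; apply: filterS => y.
rewrite in_itv /= -(F_mono (F' _)) -(F_mono y) !F'K => /andP[lo hi].
by rewrite ltr_distlC; apply/andP; split; lra.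
Qed.

(** The constant term is required to be dyadic, so that [F x] is dyadic if and only
   if [x] is: this is what keeps the break points of compositions and inverses
   dyadic. *)
Definition dyadic_germ (D : set R) F x :=
  exists (k : int) t, dyadic_rational R t /\
    \forall y \near x, D y -> F y = 2 ^ k * y + t.

Lemma dyadic_germ_comp (D E : set R) F G x :
    {for x, continuous G} -> (forall y, D y -> E (G y)) ->
    dyadic_germ E F (G x) -> dyadic_germ D G x ->
  dyadic_germ D (F \o G) x.
Proof.
move=> G_cont DE [k [t [t_dy FE]]] [l [s [s_dy GE]]].
exists (k + l), (2 ^ k * s + t); split.
  by apply: dyadic_rationalD => //; exact: dyadic_rational_exp2.
have {}FE : \forall y \near x, E (G y) -> F (G y) = 2 ^ k * G y + t.
  exact: G_cont FE.
near=> y => Dy /=.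
have FGy : E (G y) -> F (G y) = 2 ^ k * G y + t by near: y.
have Gy : D y -> G y = 2 ^ l * y + s by near: y.
rewrite FGy; last exact: DE.
by rewrite Gy // mulrDr mulrA -expfzDr ?pnatr_eq0 // addrA.
Unshelve. all: by end_near. Qed.

Lemma dyadic_germ_inv (D E : set R) F F' x :
    cancel F' F -> {for x, continuous F'} -> (forall y, D y -> E (F' y)) ->
  dyadic_germ E F (F' x) -> dyadic_germ D F' x.
Proof.
move=> F'K F'_cont DE [k [t [t_dy FE]]]; exists (- k), (- (2 ^ (- k) * t)); split.
  exact/dyadic_rationalN/dyadic_rational_exp2.
have {FE} : \forall y \near x, E (F' y) -> F (F' y) = 2 ^ k * F' y + t.
  exact: F'_cont FE.
apply: filterS => y FE Dy; have := FE (DE _ Dy); rewrite F'K => def_y.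
rewrite -mulrBr; have -> : y - t = 2 ^ k * F' y by rewrite {1}def_y addrK.
by rewrite mulrA -expfzDr ?pnatr_eq0 // addNr expr0z mul1r.
Qed.

Lemma dyadic_germ_dyadic F x : dyadic_germ [set y | x <= y] F x ->
  dyadic_rational R (F x) <-> dyadic_rational R x.
Proof.
move=> [k [t [t_dy /nbhs_singleton/(_ (lexx x)) ->]]]; split=> [Fx_dy|x_dy].
  have -> : x = 2 ^ (- k) * (2 ^ k * x + t - t).
    by rewrite addrK mulrA -expfzDr ?pnatr_eq0 // addNr expr0z mul1r.
  by apply/dyadic_rational_exp2/dyadic_rationalD => //; exact: dyadic_rationalN.
by apply: dyadic_rationalD => //; exact: dyadic_rational_exp2.
Qed.

(** A local form of membership in T, chosen because it passes to products and
   inverses by composing germs. At a break point the right germ alone determines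
   the slope, should [F] be derivable there. The inverse [F'] of the lift is part
   of the data: continuity then follows from monotonicity, and inverting [u]
   swaps [F] and [F']. *)
Record dyadic_lift u F F' : Prop := DyadicLift {
  dyadic_liftK : cancel F F';
  dyadic_liftVK : cancel F' F;
  dyadic_lift_incr : {homo F : x y / x < y};
  dyadic_liftE : forall x, u (pi x) = pi (F x);
  dyadic_lift_right : forall x, dyadic_germ [set y | x <= y] F x;
  dyadic_lift_breaks : exists2 B : set (circle R), finite_set B /\ B `<=` dyadic R &
    forall x, ~ B (pi x) -> dyadic_germ setT F x }.

Lemma dyadic_lift_continuous u F F' : dyadic_lift u F F' -> continuous F.
Proof. by case=> FK F'K F_incr *; exact: (increasing_bij_continuous FK F'K F_incr). Qed.

Lemma circle_pi_surj (c : circle R) : exists x, c = pi x.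
Proof. by exists (repr c); rewrite /pi /circle_pi reprK. Qed.

Lemma dyadic_lift_mul u v F F' G G' :
  dyadic_lift u F F' -> dyadic_lift v G G' ->
  dyadic_lift (u * v)%g (F \o G) (G' \o F').
Proof.
move=> uF vG; have G_cont := dyadic_lift_continuous vG.
case: uF => FK F'K F_incr FE F_right [B [B_fin B_dy] F_br].
case: vG => GK G'K G_incr GE G_right [C [C_fin C_dy] G_br].
have vVE x : (v^-1)%g (pi x) = pi (G' x).
  rewrite -{1}(G'K x) -GE -[LHS]/((v^-1 * v)%g (pi (G' x))).
  by rewrite mulVg.
split.
- exact: can_comp.
- exact: can_comp.
- by move=> x y xy; apply/F_incr/G_incr.
- by move=> x /=; rewrite GE FE.
- move=> x; apply: dyadic_germ_comp (F_right _) (G_right x); first exact: G_cont.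
  by move=> y /=; rewrite (le_mono G_incr).
exists (C `|` (v^-1)%g @` B); first split.
- by rewrite finite_setU; split=> //; exact: finite_image.
- move=> c [/C_dy //|[d Bd <-]]; have [x def_d] := circle_pi_surj d.
  rewrite def_d vVE; apply/dyadic_circle_piP.
  apply/(dyadic_germ_dyadic (G_right (G' x))); rewrite G'K.
  by apply/dyadic_circle_piP; apply: B_dy; rewrite -/pi -def_d.
move=> x /not_orP[nCx nBx].
apply: (dyadic_germ_comp (E := setT)); [exact: G_cont | by [] | | exact: G_br].
apply: F_br => BGx; apply: nBx; exists (pi (G x)) => //.
by rewrite vVE GK.
Qed.

Lemma dyadic_lift_inv u F F' : dyadic_lift u F F' -> dyadic_lift (u^-1)%g F' F.
Proof.
case=> FK F'K F_incr FE F_right [B [B_fin B_dy] F_br].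
have F_mono := le_mono F_incr.
have F'_mono : {mono F' : x y / x <= y} by exact: can_mono F'K F_mono.
have F'_incr : {homo F' : x y / x < y} by move=> x y; rewrite (leW_mono F'_mono).
have F'_cont := increasing_bij_continuous F'K FK F'_incr.
split=> //.
- move=> x; rewrite -{1}(F'K x) -FE -[LHS]/((u^-1 * u)%g (pi (F' x))).
  by rewrite mulVg.
- move=> x; apply: dyadic_germ_inv (F_right (F' x)) => //; first exact: F'_cont.
  by move=> y /=; rewrite F'_mono.
exists (u @` B); first split.
- exact: finite_image.
- move=> _ [d Bd <-]; have [x def_d] := circle_pi_surj d.
  rewrite def_d FE; apply/dyadic_circle_piP; apply/(dyadic_germ_dyadic (F_right x)).
  by apply/dyadic_circle_piP; apply: B_dy; rewrite -/pi -def_d.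
move=> x nBx; apply: (dyadic_germ_inv (E := setT) F'K) => //; first exact: F'_cont.
by apply: F_br => BFx; apply: nBx; exists (pi (F' x)); rewrite ?FE ?F'K.
Qed.

Lemma dyadic_germ_is_derive F x : dyadic_germ setT F x ->
  exists k : int, \forall y \near x, is_derive (y : R) (1 : R) F (2 ^ k).
Proof.
move=> [k [t [_ Fx]]]; exists k.
apply: filterS (nbhs_interior Fx) => y Fy.
apply: (@near_eq_is_derive R R R (fun z => 2 ^ k * z + t)).
  by apply: filterS Fy => z FE; rewrite FE.
by apply: is_derive_eq; rewrite addr0 [LHS]mulr1.
Qed.

(** Off the break points the derivative is locally constant, so it has derivative
   zero; the mean value theorem, used for the derivative and then for [F] itself,
   shows that [F] is affine between two break points. *)
Lemma affine_of_germs F a b :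
    (forall x, a < x < b -> dyadic_germ setT F x) ->
  exists s t : R, forall x, a < x < b -> F x = s * x + t.
Proof.
move=> F_germ; have [lt_ab|le_ba] := ltP a b; last first.
  by exists 0, 0 => x /andP[/lt_trans/[apply]]; rewrite ltNge le_ba.
have F_der x : a < x < b -> is_derive x 1 F ('D_1 F x).
  by move=> /F_germ/dyadic_germ_is_derive[k /nbhs_singleton[? _]]; split.
have dF_der x : a < x < b -> is_derive x 1 ('D_1 F) 0.
  move=> /F_germ/dyadic_germ_is_derive[k FD].
  apply: (@near_eq_is_derive R R R (cst (2 ^ k : R))).
  by apply: filterS FD => y [_].
have mvt f (df : R -> R) x y : (forall z, a < z < b -> is_derive z 1 f (df z)) ->
    a < x -> x < y -> y < b ->
    exists2 c, a < c < b & f y - f x = df c * (y - x).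
  move=> f_der ax xy yb; have sub z : z \in `[x, y] -> a < z < b.
    rewrite in_itv /= => /andP[xz zy].
    by rewrite (lt_le_trans ax xz) (le_lt_trans zy yb).
  have [||c c_in fE] := @MVT R f df x y xy.
  - by move=> z z_in; apply/f_der/sub/subset_itv_oo_cc.
  - apply: derivable_within_continuous => z z_in.
    by have [] := f_der z (sub z z_in).
  by exists c => //; apply/sub/subset_itv_oo_cc.
have dF_cst x y : a < x < b -> a < y < b -> 'D_1 F x = 'D_1 F y.
  wlog lt_xy : x y / x < y => [wl xab yab|/andP[ax _] /andP[_ yb]].
    have [xy|yx|->//] := ltgtP x y; first exact: wl.
    by apply: esym; apply: wl.
  have [c _ /eqP] := mvt ('D_1 F) (cst 0) x y dF_der ax lt_xy yb.
  by rewrite /cst mul0r subr_eq0 => /eqP.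
pose o := (a + b) / 2.
have o_in : a < o < b by rewrite /o; apply/andP; split; lra.
have incr x y : a < x -> x < y -> y < b -> F y - F x = 'D_1 F o * (y - x).
  move=> ax xy yb; have [c c_in ->] := mvt F ('D_1 F) x y F_der ax xy yb.
  by rewrite (dF_cst c o).
exists ('D_1 F o), (F o - 'D_1 F o * o) => x /andP[ax xb].
have [ao ob] := andP o_in.
have [xo|ox|->] := ltgtP x o; last by rewrite addrC subrK.
  by have := incr _ _ ax xo ob; lra.
by have := incr _ _ ao ox xb; lra.
Qed.

(** The derivative is also the limit of the difference quotient from the right. *)
Lemma dyadic_germ_derive F x : dyadic_germ [set y | x <= y] F x ->
  derivable F x 1 -> exists k : int, 'D_1 F x = 2 ^ k.
Proof.
move=> [k [t [_ FE]]] F_der; exists k.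
have Fx : F x = 2 ^ k * x + t by apply: (nbhs_singleton FE); exact: lexx.
pose q h := h^-1 *: ((F \o shift x) (h *: 1) - F x).
have Fl : q h @[h --> 0^'] --> 'D_1 F x by exact: F_der.
have Fl_right : q h @[h --> 0^'+] --> 'D_1 F x by exact: cvg_dnbhs_at_right.
apply: (cvg_unique (@norm_hausdorff R R) Fl_right); apply: cvg_near_cst.
have {}FE : \forall h \near 0^'+, x <= h + x -> F (h + x) = 2 ^ k * (h + x) + t.
  apply: cvg_within.
  have shift_cont : h + x @[h --> (0 : R)] --> x.
    by rewrite -[X in _ --> X]add0r; apply: cvgD; [exact: cvg_id|exact: cvg_cst].
  exact: shift_cont FE.
near=> h; have h_gt0 : 0 < h by [].
have FhE : x <= h + x -> F (h + x) = 2 ^ k * (h + x) + t by near: h.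
rewrite /q /= [h *: 1]mulr1 FhE ?lerDr ?ltW // Fx.
have -> : 2 ^ k * (h + x) + t - (2 ^ k * x + t) = h * 2 ^ k by ring.
by rewrite [_ *: _]mulKf // gt_eqF.
Unshelve. all: by end_near. Qed.

Lemma dyadic_lift_thompson u F F' : dyadic_lift u F F' -> thompson_T R u.
Proof.
move=> uF; have F_cont := dyadic_lift_continuous uF.
case: uF => FK F'K F_incr FE F_right [B [B_fin B_dy] F_br]; split.
  move=> _ [_ [x x_dy <-] <-]; rewrite FE; apply/dyadic_circle_piP.
  exact/(dyadic_germ_dyadic (F_right x)).
exists F; split=> //.
- exists B => // a b ab_B; apply: affine_of_germs => x /ab_B; exact: F_br.
- exists B => // x /F_br/dyadic_germ_is_derive[k /nbhs_singleton[]].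
  by [].
- by move=> x; apply: dyadic_germ_derive.
Qed.

Definition dyadic_liftable u := exists F F', dyadic_lift u F F'.

Lemma dyadic_liftable_thompson u : dyadic_liftable u -> thompson_T R u.
Proof. by move=> [F [F' uF]]; exact: dyadic_lift_thompson uF. Qed.

Lemma dyadic_liftableM u v :
  dyadic_liftable u -> dyadic_liftable v -> dyadic_liftable (u * v)%g.
Proof.
by move=> [F [F' uF]] [G [G' vG]]; do 2 eexists; exact: dyadic_lift_mul uF vG.
Qed.

Lemma dyadic_liftableV u : dyadic_liftable u -> dyadic_liftable (u^-1)%g.
Proof. by move=> [F [F' uF]]; do 2 eexists; exact: dyadic_lift_inv uF. Qed.

Lemma dyadic_liftableX u n : dyadic_liftable u -> dyadic_liftable (u ^+ n)%g.
Proof.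
move=> u_lift; elim: n => [|n IHn].
  by rewrite expg0 -(mulgV u); apply: dyadic_liftableM => //; exact: dyadic_liftableV.
by rewrite expgS; exact: dyadic_liftableM.
Qed.

Lemma dyadic_liftXE u F F' n x :
  dyadic_lift u F F' -> (u ^+ n)%g (pi x) = pi (iter n F x).
Proof.
move=> uF; elim: n => // n IHn.
by rewrite expgS -[LHS]/(u ((u ^+ n)%g (pi x))) IHn (dyadic_liftE uF).
Qed.
(** * Circle homeomorphisms from dyadic affine pieces *)

Definition dyadic_affine (F : R -> R) (A : set R) :=
  exists (k : int) t, dyadic_rational R t /\ forall y, A y -> F y = 2 ^ k * y + t.

Definition grid_cell (N : nat) (j : int) : set R :=
  [set x | j%:~R / 2 ^+ N <= x < (j + 1)%:~R / 2 ^+ N].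

Lemma periodic_int F : (forall x, F (x + 1) = F x + 1) ->
  forall x (m : int), F (x + m%:~R) = F x + m%:~R.
Proof.
move=> F1; have Fn x (n : nat) : F (x + n%:R) = F x + n%:R.
  by elim: n => [|n IHn]; rewrite ?addr0 // -natr1 !addrA F1 IHn.
move=> x [n|n]; first exact: Fn.
rewrite NegzE rmorphN /=; apply: (addIr n.+1%:R).
by rewrite -Fn !subrK.
Qed.

Lemma grid_cell_floor N x : grid_cell N (Num.floor (x * 2 ^+ N)) x.
Proof.
have p2 : 0 < (2 ^+ N : R) by rewrite exprn_gt0.
by rewrite /grid_cell /= ler_pdivrMr // ltr_pdivlMr // floor_itv.
Qed.

(** Commuting with the unit translation makes [F] and [F'] descend to inverse
   homeomorphisms of the circle. Of the grid points [j / 2 ^ N], only [2 ^ N] are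
   distinct on the circle, and they contain the break points. *)
Lemma dyadic_lift_exists F F' (N : nat) :
    cancel F F' -> cancel F' F -> {homo F : x y / x < y} ->
    (forall x, F (x + 1) = F x + 1) ->
    (forall j, dyadic_affine F (grid_cell N j)) ->
  exists u, dyadic_lift u F F'.
Proof.
move=> FK F'K F_incr F1 F_grid.
have F_mono := le_mono F_incr.
have F'_mono : {mono F' : x y / x <= y} by exact: can_mono F'K F_mono.
have F'_incr : {homo F' : x y / x < y} by move=> x y; rewrite (leW_mono F'_mono).
have F_cont := increasing_bij_continuous FK F'K F_incr.
have F'_cont := increasing_bij_continuous F'K FK F'_incr.
have F'1 x : F' (x + 1) = F' x + 1.
  by apply: (can_inj FK); rewrite F'K F1 F'K.
pose descend G := fun c : circle R => pi (G (repr c)).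
have descendE G : (forall x, G (x + 1) = G x + 1) ->
    forall x, descend G (pi x) = pi (G x).
  move=> G1 x; apply/circle_piP.
  have /circle_piP[m ->] : pi (repr (pi x)) = pi x by rewrite /pi /circle_pi reprK.
  by exists m; exact: periodic_int.
have descend_cont G : continuous G -> (forall x, G (x + 1) = G x + 1) ->
    continuous (descend G).
  move=> G_cont G1; apply/quotient_continuous.
  have -> : descend G \o \pi_(circle R)%qT = pi \o G.
    by apply/funext => x; exact: descendE.
  move=> x; apply: continuous_comp; first exact: G_cont.
  exact: pi_continuous.
have u_homeo : homeomorphism (descend F).
  split; first exact: descend_cont.
  exists (descend F'); split; first exact: descend_cont.
    by move=> c; have [x ->] := circle_pi_surj c; rewrite !descendE // FK.
  by move=> c; have [x ->] := circle_pi_surj c; rewrite !descendE // F'K.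
exists (Homeo (asboolT u_homeo)); split=> //.
- exact: descendE.
- move=> x; have := grid_cell_floor N x; set j := Num.floor _ => /andP[jx xj].
  have [k [t [t_dy FE]]] := F_grid j; exists k, t; split=> //.
  near=> y => /= xy; apply: FE; rewrite /grid_cell /= (le_trans jx xy) /=.
  by near: y; exact: lt_nbhsl.
pose B := [set pi (i%:R / 2 ^+ N) | i in `I_(2 ^ N)].
exists B; first split.
- by apply: finite_image; exact: finite_II.
- move=> _ [i _ <-]; apply/dyadic_circle_piP.
  by exists i%:Z, N.
move=> x nBx; have := grid_cell_floor N x; set j := Num.floor _ => /andP[jx xj].
have {jx} jx : j%:~R / 2 ^+ N < x.
  rewrite lt_neqAle jx andbT; apply: contra_notN nBx => /eqP <-.
  have p2 : (2 ^ N)%:Z != 0 by rewrite -lt0n expn_gt0.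
  (* j and its remainder modulo 2 ^ N give the same point of the circle *)
  exists `|(j %% (2 ^ N)%:Z)%Z|%N.
    by rewrite /= -ltz_nat gez0_abs ?modz_ge0 // ltz_pmod // ltz_nat expn_gt0.
  apply/circle_piP; exists (- (j %/ (2 ^ N)%:Z)%Z).
  have p2' : (2 ^+ N : R) != 0 by rewrite expf_neq0 // pnatr_eq0.
  rewrite -[X in X / _]/((`|(j %% (2 ^ N)%:Z)%Z|%N)%:Z%:~R) gez0_abs ?modz_ge0 //.
  rewrite {2}(divz_eq j (2 ^ N)%:Z) !rmorphD rmorphM rmorphN /=.
  by rewrite -[(2 ^ N)%:Z%:~R]/((2 ^ N)%:R) natrX; field.
have [k [t [t_dy FE]]] := F_grid j; exists k, t; split=> //.
near=> y => _; apply: FE; rewrite /grid_cell /=; apply/andP; split.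
  by apply: ltW; near: y; exact: lt_nbhsr.
by near: y; exact: lt_nbhsl.
Unshelve. all: by end_near. Qed.

End Lifts.

(** * The element stretch of Thompson's group F *)

Section Dynamics.
Import numFieldNormedType.Exports.
Local Open Scope ring_scope.
Variable R : realType.
Implicit Types (F G f : R -> R) (x y z : R) (k m : nat).

Definition periodize f x : R := (Num.floor x)%:~R + f (x - (Num.floor x)%:~R).

Definition unit_map f := forall x, 0 <= x < 1 -> 0 <= f x < 1.

Lemma periodizeE f x (m : int) :
  m%:~R <= x < m%:~R + 1 -> periodize f x = m%:~R + f (x - m%:~R).
Proof.
move=> xm; rewrite /periodize; suff -> : Num.floor x = m by [].
by apply: floor_def; rewrite rmorphD.
Qed.

Lemma floor_frac x : exists m : int, m%:~R <= x < m%:~R + 1.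
Proof. by exists (Num.floor x); have := floor_itv x; rewrite rmorphD. Qed.

Lemma periodize1 f x : periodize f (x + 1) = periodize f x + 1.
Proof.
have [m xm] := floor_frac x; rewrite (periodizeE f xm) (@periodizeE f _ (m + 1)).
  by rewrite rmorphD addrAC; congr (_ + f _ + _); ring.
by rewrite rmorphD; lra.
Qed.

Lemma periodizeK f g : unit_map f -> (forall x, 0 <= x < 1 -> g (f x) = x) ->
  cancel (periodize f) (periodize g).
Proof.
move=> f01 fK x; have [m xm] := floor_frac x; rewrite (periodizeE f xm).
have x01 : 0 <= x - m%:~R < 1 by lra.
have fx01 := f01 _ x01.
rewrite (@periodizeE g _ m); last by lra.
by rewrite addrAC subrr add0r fK // addrC subrK.
Qed.

Lemma periodize_incr f : unit_map f ->
    (forall x y, 0 <= x -> x < y -> y < 1 -> f x < f y) ->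
  {homo periodize f : x y / x < y}.
Proof.
move=> f01 f_incr x y xy.
have [m xm] := floor_frac x; have [n yn] := floor_frac y.
rewrite (periodizeE f xm) (periodizeE f yn).
have fx01 : 0 <= f (x - m%:~R) < 1 by apply: f01; lra.
have fy01 : 0 <= f (y - n%:~R) < 1 by apply: f01; lra.
have [lt_mn|lt_nm|eq_mn] := ltgtP m n.
- have : (m + 1)%:~R <= n%:~R :> R by rewrite ler_int lezD1.
  by rewrite rmorphD /=; lra.
- have : (n + 1)%:~R <= m%:~R :> R by rewrite ler_int lezD1.
  by rewrite rmorphD /=; lra.
by rewrite -eq_mn in yn *; rewrite ltrD2l; apply: f_incr; lra.
Qed.

Definition bend x : R :=
  if x < 1 / 4 then 2 * x else if x < 1 / 2 then x + 1 / 4 else (x + 1) / 2.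

Definition bend_inv x : R :=
  if x < 1 / 2 then x / 2 else if x < 3 / 4 then x - 1 / 4 else 2 * x - 1.

Definition stretch := periodize bend.
Definition stretch_inv := periodize bend_inv.

Lemma bend01 : unit_map bend.
Proof.
by move=> x; rewrite /bend; case: (ltP x (1 / 4)); [|case: (ltP x (1 / 2))]; lra.
Qed.

Lemma bend_inv01 : unit_map bend_inv.
Proof.
by move=> x; rewrite /bend_inv; case: (ltP x (1 / 2)); [|case: (ltP x (3 / 4))]; lra.
Qed.

Lemma bend_incr x y : x < y -> bend x < bend y.
Proof.
by rewrite /bend; case: (ltP x (1 / 4)); [|case: (ltP x (1 / 2))];
  case: (ltP y (1 / 4)); [|case: (ltP y (1 / 2))| |case: (ltP y (1 / 2))|
  |case: (ltP y (1 / 2))]; lra.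
Qed.

Lemma bendK x : bend_inv (bend x) = x.
Proof.
rewrite /bend; case: (ltP x (1 / 4)) => x4; [|case: (ltP x (1 / 2)) => x2];
  rewrite /bend_inv.
- by rewrite ifT; lra.
- by rewrite ifF ?ifT; lra.
- by rewrite ifF ?ifF; lra.
Qed.

Lemma bend_invK x : bend (bend_inv x) = x.
Proof.
rewrite /bend_inv; case: (ltP x (1 / 2)) => x2; [|case: (ltP x (3 / 4)) => x3];
  rewrite /bend.
- by rewrite ifT; lra.
- by rewrite ifF ?ifT; lra.
- by rewrite ifF ?ifF; lra.
Qed.

Lemma stretchK : cancel stretch stretch_inv.
Proof. by apply: periodizeK => [|x _]; [exact: bend01|exact: bendK]. Qed.

Lemma stretch_invK : cancel stretch_inv stretch.
Proof. by apply: periodizeK => [|x _]; [exact: bend_inv01|exact: bend_invK]. Qed.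

Lemma stretch_incr : {homo stretch : x y / x < y}.
Proof. by apply: periodize_incr => [|x y _ /bend_incr]; first exact: bend01. Qed.

Lemma stretchE x : 0 <= x < 1 -> stretch x = bend x.
Proof. by move=> x01; rewrite /stretch (@periodizeE _ _ 0) ?subr0 ?add0r. Qed.

Lemma stretch_grid j : dyadic_affine stretch (grid_cell 2 j).
Proof.
pose m := (j %/ 4)%Z; pose r := (j %% 4)%Z.
have jE : j = m * 4 + r by exact: divz_eq.
have r_ge0 : 0 <= r by exact: modz_ge0.
have r_lt4 : r < 4 by exact: ltz_pmod.
have m_dy := dyadic_rational_int R m.
have cellE (y : R) : grid_cell 2 j y ->
    m%:~R + r%:~R / 4 <= y < m%:~R + r%:~R / 4 + 1 / 4.
  by rewrite /grid_cell /= jE !rmorphD rmorphM /=; lra.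
have dy0 := dyadic_rational_int R 0.
have dy1 := dyadic_rational_int R 1.
have [r0|[r1|r23]] : r = 0 \/ r = 1 \/ 2 <= r by lia.
- exists 1, (- m%:~R); split; first exact: dyadic_rationalN.
  move=> y /cellE; rewrite r0 => y_in.
  rewrite /stretch (@periodizeE _ _ m) /bend; last by lra.
  by rewrite expr1z ifT; lra.
- exists 0, (1 / 2 / 2); split; first exact/dyadic_rational_half/dyadic_rational_half.
  move=> y /cellE; rewrite r1 => y_in.
  rewrite /stretch (@periodizeE _ _ m) /bend; last by lra.
  by rewrite expr0z ifF ?ifT; lra.
exists (- 1), ((m%:~R + 1) / 2); split; first exact/dyadic_rational_half/dyadic_rationalD.
have r_ge2 : 2 <= r%:~R :> R by rewrite -[2]/(2%:~R) ler_int.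
have r_le3 : r%:~R <= 3 :> R by rewrite -[3]/(3%:~R) ler_int; lia.
move=> y /cellE y_in.
rewrite /stretch (@periodizeE _ _ m) /bend; last by lra.
by rewrite exprN1 ifF ?ifF; lra.
Qed.

(** Conjugation by the doubling map: [halve F] commutes with the translation by
   [1 / 2] when [F] commutes with the unit translation. *)
Definition halve F x : R := F (2 * x) / 2.

Lemma halveK F F' : cancel F F' -> cancel (halve F) (halve F').
Proof.
move=> FK x; rewrite /halve; have -> : 2 * (F (2 * x) / 2) = F (2 * x) by field.
by rewrite FK; field.
Qed.

Lemma halve_grid F N : (forall j, dyadic_affine F (grid_cell N j)) ->
  forall j, dyadic_affine (halve F) (grid_cell N.+1 j).
Proof.
move=> F_grid j; have [k [t [t_dy FE]]] := F_grid j.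
exists k, (t / 2); split; first exact: dyadic_rational_half.
move=> y y_in; rewrite /halve FE; first by field.
have p2 : 0 < (2 ^+ N : R) by rewrite exprn_gt0.
move: y_in; rewrite /grid_cell /= exprS => /andP[jy yj]; apply/andP; split.
  rewrite ler_pdivrMr //; move: jy; rewrite ler_pdivrMr ?mulr_gt0 //; lra.
rewrite ltr_pdivlMr //; move: yj; rewrite ltr_pdivlMr ?mulr_gt0 //; lra.
Qed.

Lemma translation_lift (a : R) : dyadic_rational R a ->
  exists u, dyadic_lift u (fun x => x + a) (fun x => x - a).
Proof.
move=> a_dy; apply: (@dyadic_lift_exists _ _ _ 0).
- by move=> x; rewrite addrK.
- by move=> x; rewrite subrK.
- by move=> x y; rewrite ltrD2r.
- by move=> x; rewrite addrAC.
by move=> j; exists 0, a; split=> // y _; rewrite expr0z mul1r.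
Qed.

Lemma stretch_lift : exists u, dyadic_lift u stretch stretch_inv.
Proof.
apply: (@dyadic_lift_exists _ _ _ 2).
- exact: stretchK.
- exact: stretch_invK.
- exact: stretch_incr.
- exact: periodize1.
exact: stretch_grid.
Qed.

Lemma halve_stretch_lift :
  exists u, dyadic_lift u (halve stretch) (halve stretch_inv).
Proof.
apply: (@dyadic_lift_exists _ _ _ 3).
- exact/halveK/stretchK.
- exact/halveK/stretch_invK.
- by move=> x y xy; rewrite /halve ltr_pM2r // stretch_incr // ltr_pM2l.
- move=> x; rewrite /halve; have -> : 2 * (x + 1) = 2 * x + 1 + 1 by ring.
  by rewrite /stretch !periodize1; field.
exact/halve_grid/stretch_grid.
Qed.

(** * Dynamics of stretch *)

Lemma iter_halve F n x : iter n (halve F) x = iter n F (2 * x) / 2.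
Proof.
elim: n => [|n IHn]; first by rewrite /=; field.
rewrite !iterS IHn /halve; congr (F _ / 2); by field.
Qed.

Lemma iter_stretch_incr n : {homo iter n stretch : x y / x < y}.
Proof. by elim: n => // n IHn x y xy; rewrite !iterS stretch_incr // IHn. Qed.

Lemma iter_stretch_le n x y : x <= y -> iter n stretch x <= iter n stretch y.
Proof. by rewrite (le_mono (@iter_stretch_incr n)). Qed.

Lemma iter_stretch01 n x : 0 < x < 1 -> 0 < iter n stretch x < 1.
Proof.
move=> x01; elim: n => // n; rewrite iterS; set y := iter n _ _ => y01.
rewrite stretchE ?(ltW (andP y01).1) ?(andP y01).2 // /bend.
by case: (ltP y (1 / 4)) => ?; [|case: (ltP y (1 / 2)) => ?]; lra.
Qed.

Lemma iter_stretch0 n : iter n stretch 0 = 0.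
Proof.
elim: n => // n IHn; rewrite iterS IHn stretchE; last by lra.
by rewrite /bend ifT; lra.
Qed.

Lemma inv_exp2_bounds k : 0 < (2 ^- k : R) <= 1.
Proof.
by rewrite invr_gt0 exprn_gt0 //= invf_le1 ?exprn_gt0 // exprn_ege1 // ler1n.
Qed.

Lemma inv_exp2S k : (2 ^- k.+1 : R) = 2 ^- k / 2.
Proof. by rewrite exprS invfM mulrC. Qed.

Lemma iter_stretch_double n j : iter n stretch (2 ^- (n + j).+1) = 2 ^- j.+1.
Proof.
elim: n => // n IHn; rewrite iterSr -IHn; congr iter.
have := inv_exp2_bounds (n + j); rewrite addSn (inv_exp2S (n + j).+1) inv_exp2S.
move: (2 ^- (n + j)) => e e01; rewrite stretchE; last by lra.
rewrite /bend; have [e_lt|e_ge] := ltP (e / 2 / 2) (1 / 4); first by lra.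
by rewrite ifT; lra.
Qed.

Lemma iter_stretch_half n : iter n stretch (1 / 2) = 1 - 2 ^- n.+1.
Proof.
elim: n => [|n IHn]; first by rewrite expr1 /=; lra.
rewrite iterS IHn (inv_exp2S n.+1) inv_exp2S; have := inv_exp2_bounds n.
move: (2 ^- n) => e e01; rewrite stretchE; last by lra.
by rewrite /bend ifF ?ifF; lra.
Qed.

(** [k] steps take [2 ^- k.+1] to [1 / 2], and the next step goes beyond. *)
Lemma iter_stretch_gt_half k n x : (k < n)%N -> 2 ^- k.+1 <= x -> 1 / 2 < iter n stretch x.
Proof.
move=> /subnK <-; rewrite addnS -addSn iterD => /(iter_stretch_le k).
have := iter_stretch_double k 0; rewrite addn0 expr1 => -> /(iter_stretch_le (n - k.+1).+1).
apply: lt_le_trans; rewrite -[2^-1]mul1r iter_stretch_half inv_exp2S inv_exp2S.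
by have := inv_exp2_bounds (n - k.+1); lra.
Qed.

Lemma int_between01 (m : int) : ~ (0 < (m%:~R : R) < 1).
Proof. by rewrite ltr0z -[1]/(1%:~R) ltr_int => ?; lia. Qed.

(** [m.+1] steps take the end points [2 ^- (2m+2)] and [1 / 4] of the arc to
   [2 ^- m.+1] and [1 - 2 ^- m.+1], so a point outside the arc ends up close to an
   integer. So the iterates of [stretch] spread an arc between 0 and 1/4 over the
   complement of an arbitrarily small arc around 0. *)
Lemma stretch_out_arc m x : 0 <= x < 1 -> ~ (2 ^- (m.+1 + m).+1 <= x <= 1 / 4) ->
  exists n : int, `|iter m.+1 stretch x + n%:~R| < 2 ^- m.
Proof.
move=> x01 x_out; have eps := inv_exp2_bounds m; have epsS := inv_exp2S m.
have := iter_stretch_double m.+1 m; set d := 2 ^- _ => dE.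
have [x_lt|x_ge] := ltP x d.
  exists 0; rewrite addr0; have := iter_stretch_incr m.+1 x_lt; rewrite dE.
  have : iter m.+1 stretch 0 <= iter m.+1 stretch x by apply: iter_stretch_le; lra.
  by rewrite iter_stretch0 => x_ge /=; rewrite ger0_norm //; lra.
have x_gt : 1 / 4 < x by rewrite ltNge; apply/negP => ?; apply: x_out; apply/andP.
exists (- 1); have x01' : 0 < x < 1 by lra.
have := iter_stretch01 m.+1 x01'; have := iter_stretch_incr m.+1 x_gt.
have -> : iter m.+1 stretch (1 / 4) = 1 - 2 ^- m.+1.
  rewrite iterSr -iter_stretch_half; congr iter.
  by rewrite stretchE /bend; [rewrite ifF ?ifT; lra|lra].
by rewrite rmorphN1 => x_in x_in1; rewrite ltr0_norm; lra.
Qed.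

(** * Arcs moved off themselves *)

(** At a common support point, a lift of [h] moves [x0] by a non-integer amount. By
   continuity this persists for nearby points, uniformly in [h] as [H] is finite;
   finally the centre of the arc is moved to a dyadic point. *)
Lemma moved_arc (H : set (homeo (circle R))) :
    finite_set H -> H `<=` thompson_T R -> \bigcap_(h in H) Supp h !=set0 ->
  exists m a, dyadic_rational R a /\ forall h, H h -> forall s t,
    `|s| < 2 ^- m -> `|t| < 2 ^- m -> h (circle_pi (a + s)) <> circle_pi (a + t).
Proof.
move=> /finite_fsetP[D HE] H_T [p p_supp]; have [x0 p_x0] := circle_pi_surj p.
pose P (h : homeo (circle R)) n := forall s t, `|s - x0| < 2 ^- n -> `|t - x0| < 2 ^- n ->
  h (circle_pi s) <> circle_pi t.
have P_near h : h \in D -> \forall n \near \oo, P h n.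
  move=> hD; have Hh : H h by rewrite HE.
  have [_ [F [[F_cont FE] _ _ _ _]]] := H_T h Hh.
  have [m xm] := floor_frac (F x0 - x0).
  have m_neq : F x0 - x0 != m%:~R.
    apply/eqP => def_m; apply: (p_supp h Hh); rewrite p_x0 FE.
    by apply/circle_piP; exists m; lra.
  (* half the distance from the displacement of x0 to the nearest integer *)
  pose e := Num.min (F x0 - x0 - m%:~R) (m%:~R + 1 - (F x0 - x0)) / 2.
  have e_gt0 : 0 < e.
    by rewrite divr_gt0 // lt_min !subr_gt0 lt_neqAle eq_sym m_neq; case/andP: xm => -> ->.
  have [e_m e_m1] : e * 2 <= F x0 - x0 - m%:~R /\ e * 2 <= m%:~R + 1 - (F x0 - x0).
    by rewrite /e divfK ?pnatr_eq0 // !ge_min !lexx orbT.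
  have /cvgrPdist_lt/(_ e e_gt0)/nbhs_ballP[d /= d_gt0 dF] := F_cont x0.
  have [N eN] : exists N, 2 ^- N < Num.min d e.
    have de_gt0 : 0 < Num.min d e by rewrite lt_min d_gt0.
    exists (Num.bound (Num.min d e)^-1); rewrite -[X in _ < X]invrK.
    rewrite ltf_pV2 ?posrE ?exprn_gt0 ?invr_gt0 //.
    apply: (lt_trans (archi_boundP _)); first by rewrite invr_ge0 ltW.
    by rewrite -natrX ltr_nat ltn_expl.
  exists N => // n /= le_Nn s t s_near t_near; rewrite FE => /circle_piP[k st].
  have nN : 2 ^- n <= 2 ^- N :> R.
    by rewrite lef_pV2 ?posrE ?exprn_gt0 // ler_weXn2l // ler1n.
  move: eN; rewrite lt_min => /andP[Nd Ne].
  have Fs : `|F x0 - F s| < e.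
    by apply: dF; rewrite /ball /= distrC; lra.
  move: Fs t_near; rewrite !ltr_norml => Fs t_near.
  by apply: (@int_between01 (k - m)); rewrite rmorphB /=; lra.
have [N _ PN] : \forall n \near \oo, (\bigcap_(h in [set` D]) P h) n.
  exact: filter_bigI.
pose j := Num.floor (x0 * 2 ^+ N.+1); pose a : R := j%:~R / 2 ^+ N.+1.
exists N.+1, a; split; first by exists j, N.+1.
have x0a : 0 <= x0 - a < 2 ^- N / 2.
  have := grid_cell_floor N.+1 x0; rewrite /grid_cell /= -/j rmorphD mulrDl mul1r.
  by rewrite -/a -inv_exp2S; lra.
move=> h; rewrite HE => Dh s t; rewrite !inv_exp2S !ltr_norml => s_lt t_lt.
by have := PN N (leqnn N) h Dh; apply; rewrite ltr_norml; lra.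
Qed.

End Dynamics.

(** * The theorem *)

Theorem lemma13 (R : realType) (H : set (homeo (circle R)))
    (H_fin : finite_set H) (H_T : H `<=` thompson_T R)
    (H_neq1 : forall h, H h -> h <> 1)
    (H_supp : \bigcap_(h in H) Supp h !=set0)
    (n : nat) (n_gt0 : (0 < n)%N) :
  exists2 g : homeo (circle R), thompson_T R g &
  exists2 c : 'I_n -> homeo (circle R),
    (forall i, centralizer_in (thompson_T R) g (c i)) &
    forall h, H h ->
      let G_h := [set conjl (g * h) (c i) | i in [set: 'I_n]] in
      is_free_basis G_h (gen_subgroup G_h) /\ (G_h #= `I_n)%card.
Proof.
pose pi := @circle_pi R.
have [m [a [a_dy moved]]] := moved_arc H_fin H_T H_supp.
have [tau tauL] := translation_lift a_dy.
have half_dy := dyadic_rational_half (dyadic_rational_int R 1).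
have [rho rhoL] := translation_lift half_dy.
have [s sL] := stretch_lift R.
have [w wL] := halve_stretch_lift R.
have [phi phi_lift phiE] : exists2 phi, dyadic_liftable phi &
    forall x, phi (pi x) = pi (iter m.+1 (@stretch R) x + a)%R.
  exists (tau * s ^+ m.+1) => [|x].
    by apply: dyadic_liftableM; [|apply: dyadic_liftableX]; do 2 eexists; eassumption.
  rewrite -[LHS]/(tau ((s ^+ m.+1) (pi x))) (dyadic_liftXE _ _ sL).
  exact: (dyadic_liftE tauL).
have rhoE x : rho (pi x) = pi (x + 1 / 2)%R by exact: (dyadic_liftE rhoL x).
have wXE k x : (w ^+ k) (pi x) = pi (iter k (@stretch R) (2 * x) / 2)%R.
  by rewrite (dyadic_liftXE _ _ wL) iter_halve.
have w_rho : commute w rho.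
  apply: homeo_ext => p; have [x ->] := circle_pi_surj p.
  rewrite -[LHS]/(w (rho (pi x))) -[RHS]/(rho (w (pi x))).
  have wE := dyadic_liftE wL; rewrite rhoE !wE rhoE; congr pi; rewrite /halve.
  have -> : (2 * (x + 1 / 2) = 2 * x + 1)%R by field.
  by rewrite /stretch periodize1; field.
(* By iter_stretch_gt_half, w ^+ M pushes the arc from 2 ^- (2m+2) to 1/4 off
   itself. *)
pose M := (m + m).+1; pose g := phi * rho * phi^-1.
pose c (i : 'I_n) := phi * w ^+ (M * i) * phi^-1.
have conj_phi u p : (phi * u * phi^-1) (phi p) = phi (u p).
  by rewrite -[LHS]/((phi * u * phi^-1 * phi) p) mulgVK.
have cg i : commute (c i) g.
  have conjM u v : phi * u * phi^-1 * (phi * v * phi^-1) = phi * (u * v) * phi^-1.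
    by rewrite !mulgA mulgVK.
  rewrite /commute /c /g !conjM; congr (_ * _ * _).
  exact/commute_sym/commuteX/commute_sym.
exists g.
  apply: dyadic_liftable_thompson; apply: dyadic_liftableM; last exact: dyadic_liftableV.
  by apply: dyadic_liftableM => //; do 2 eexists; eassumption.
exists c => [i|h Hh].
  split; last exact: cg.
  apply: dyadic_liftable_thompson.
  apply: dyadic_liftableM; last exact: dyadic_liftableV.
  apply: dyadic_liftableM => //; apply: dyadic_liftableX.
  by do 2 eexists; eassumption.
(* In the coordinate given by phi, the complement of U lies in the arc J. *)
pose e : R := (2 ^- (m.+1 + m).+1)%R.
have e_gt0 : (0 < e)%R by have /andP[] := inv_exp2_bounds R (m.+1 + m).+1.
have e_double : (2 * e = 2 ^- M)%R by rewrite /e inv_exp2S addSn /M; field.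
pose J := pi @` [set x | (e <= x <= 1 / 4)%R].
have phi_out p : ~ J p -> exists2 t : R, (`|t| < 2 ^- m)%R & phi p = pi (a + t)%R.
  have [x0 p_x0] := circle_pi_surj p; have [j j_x0] := floor_frac x0.
  pose x : R := (x0 - j%:~R)%R.
  have -> : p = pi x.
    by rewrite p_x0; apply/circle_piP; exists j; rewrite /x subrK.
  move=> nJx; have [||k k_lt] := @stretch_out_arc R m x.
  - by rewrite /x; lra.
  - by move=> x_in; apply: nJx; exists x.
  exists (iter m.+1 (@stretch R) x + k%:~R)%R => //.
  by rewrite phiE; apply/circle_piP; exists (- k)%R; rewrite rmorphN /=; ring.
have wJ k p : J p -> exists2 y : R, (0 < y < 1 / 2)%R & (w ^+ k) p = pi y.
  move=> [x /= x_in <-]; rewrite wXE; eexists; last reflexivity.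
  by have := @iter_stretch01 R k (2 * x)%R; lra.
have wJ_disj k l p q : (k < l)%N -> J p -> J q ->
    (w ^+ (M * k)) p <> (w ^+ (M * l)) q.
  move=> lt_kl [x /= x_in <-] [y /= y_in <-].
  have -> : w ^+ (M * l) = w ^+ (M * k) * w ^+ (M * (l - k)).
    by rewrite -expgnDr -mulnDr subnKC // ltnW.
  move/(@homeo_inj _ (w ^+ (M * k))); rewrite wXE => /circle_piP[j xy].
  have y_gt : (1 / 2 < iter (M * (l - k)) (@stretch R) (2 * y))%R.
    apply: (@iter_stretch_gt_half R (m + m)%N).
      by rewrite -[(m + m)%N.+1]muln1 leq_mul // subn_gt0.
    by rewrite -/M -e_double; lra.
  have := @iter_stretch01 R (M * (l - k)) (2 * y)%R.
  by move=> y_lt; apply: (@int_between01 R (- j)); rewrite rmorphN /=; lra.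
have half_disj y z : (0 < y < 1 / 2)%R -> (0 <= z < 1 / 2)%R -> pi (y + 1 / 2)%R <> pi z.
  move=> y_in z_in /circle_piP[j yz].
  by apply: (@int_between01 R j); lra.
have c_phi i p : c i (phi p) = phi ((w ^+ (M * i)) p) by exact: conj_phi.
have g_phi p : g (phi p) = phi (rho p) by exact: conj_phi.
have [|||||G_free G_inj] :=
  @ping_pong_conjugates _ _ g h c (phi @` J) (phi (pi 0%R)) cg.
- have outE p : ~ (phi @` J) p -> exists2 t : R, (`|t| < 2 ^- m)%R & p = pi (a + t)%R.
    move=> nJp; have pE : p = phi (phi^-1 p).
      by rewrite -[RHS]/((phi * phi^-1) p) mulgV.
    by rewrite pE; apply: phi_out => Jp; apply: nJp; exists (phi^-1 p).
  move=> p /outE[t t_lt ->]; apply: contrapT => /outE[t' t'_lt].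
  exact: moved.
- move=> i j _ _ [p Jp <-] [q Jq <-]; rewrite !c_phi => /(@homeo_inj _ phi) wpq.
  have [ij|ji|/val_inj//] := ltngtP i j.
    by have := wJ_disj _ _ _ _ ij Jp Jq wpq.
  by have := wJ_disj _ _ _ _ ji Jq Jp (esym wpq).
- move=> i j _ _ [p Jp <-] [q Jq <-]; rewrite !c_phi g_phi => /(@homeo_inj _ phi).
  have [y y_in ->] := wJ (M * i)%N p Jp; have [z z_in ->] := wJ (M * j)%N q Jq.
  by rewrite rhoE; apply: half_disj => //; lra.
- move=> i _ [p Jp <-]; rewrite c_phi g_phi => /(@homeo_inj _ phi).
  have [y y_in ->] := wJ (M * i)%N p Jp.
  by rewrite rhoE; apply: half_disj => //; lra.
- move=> i _ [p Jp <-]; rewrite c_phi => /(@homeo_inj _ phi).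
  have [y y_in ->] := wJ (M * i)%N p Jp.
  by move=> /circle_piP[j yj]; apply: (@int_between01 R j); lra.
move=> G_h; split=> //.
apply: (card_eq_trans (inj_card_eq _)); first by move=> ? ? _ _; exact: G_inj.
by rewrite card_eq_sym card_II.
Qed.
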